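(* Let $(\pi,\hat\pi)\in\mathbb{R}^{n}\times\mathbb{R}$ with $\hat\pi\ne0$ ($\pi=0$ is allowed), let $\pi_0<\pi_1$ be real, and let $F=\{(x,t)\in\mathbb{R}^{n+1}:\pi_0\le\pi^Tx+\hat\pi t\le\pi_1\}$. Let $K_0=\{(x,t)\in\mathbb{R}^{n+1}:\|x\|_2\le t\}$ and $\overline{K_0}=\mathrm{conv}(K_0\setminus \mathrm{int}(F))$. (1) If $0\notin(\pi_0,\pi_1)$, then $\overline{K_0}=K_0$. (2) If $0\in(\pi_0,\pi_1)$ and $\hat\pi\le-\|\pi\|_2$, then $\overline{K_0}=\{(x,t)\in K_0:\pi^Tx+\hat\pi t\le\pi_0\}$. (3) If $0\in(\pi_0,\pi_1)$ and $\hat\pi\ge\|\pi\|_2$, then $\overline{K_0}=\{(x,t)\in K_0:\pi^Tx+\hat\pi t\ge\pi_1\}$. (4) If $0\in(\pi_0,\pi_1)$ and $\hat\pi\in(-\|\pi\|_2,\|\pi\|_2)$, then $\overline{K_0}=K_0\cap C$, where $$C=\Bigl\{(x,t)\in\mathbb{R}^{n+1}:\Bigl\|P_\pi^\perp x+\frac{a\pi^Tx+b}{\|\pi\|_2^2}\pi\Bigr\|_2\le c\,\pi^Tx+d\,t+e\Bigr\},$$ with $$f=\sqrt{(\|\pi\|_2^2-\hat\pi^2)\bigl(\|\pi\|_2^2(\pi_1-\pi_0)^2-\hat\pi^2(\pi_0+\pi_1)^2\bigr)},$$ $$a=\frac{(\pi_0+\pi_1)(\|\pi\|_2^2-\hat\pi^2)}{f},\quad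 b=-\frac{2\pi_0\pi_1\|\pi\|_2^2}{f},\quad c=-\frac{4\pi_0\pi_1\hat\pi}{(\pi_1-\pi_0)f},$$ $$d=\frac{f}{(\pi_1-\pi_0)(\|\pi\|_2^2-\hat\pi^2)},\quad e=\frac{2\pi_0\pi_1(\pi_0+\pi_1)\hat\pi}{(\pi_1-\pi_0)f}.$$
   Context: For $\pi\neq 0$, $P_\pi^\perp=I-\frac{\pi\pi^T}{\|\pi\|_2^2}$. $\mathrm{int}$ is the topological interior and $\mathrm{conv}$ the convex hull. *)

(* Defs.v *)
From HB Require Import structures.
From mathcomp Require Import all_boot all_order all_algebra.
From mathcomp Require Import all_classical all_reals all_analysis.

Set Implicit Arguments.
Unset Strict Implicit.
Unset Printing Implicit Defensive.

Import Order.TTheory GRing.Theory Num.Theory.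
Import numFieldNormedType.Exports.

Local Open Scope classical_set_scope.
Local Open Scope ring_scope.

Section Defs.
Variables (R : realType) (n : nat).

(* R^(n+1) is written as pairs (x, t) in ['cV[R]_n * R^o]; [R^o] makes R a module
   over itself, so that the product is one as well. *)
Definition dot (u v : 'cV[R]_n) : R := (u^T *m v) 0 0.

(* The library norm on matrices is the sup norm, hence this definition. *)
Definition norm2 (x : 'cV[R]_n) : R := Num.sqrt (\sum_(i < n) x i 0 ^+ 2).

Definition conv_hull (A : set ('cV[R]_n * R^o)) : set ('cV[R]_n * R^o) :=
  smallest (@convex_set R ('cV[R]_n * R^o)%type) A.

Definition K0 : set ('cV[R]_n * R^o) :=
  [set z : 'cV[R]_n * R^o | norm2 z.1 <= z.2].

(* Only meaningful for p != 0. *)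
Definition Pperp (p : 'cV[R]_n) : 'M[R]_n :=
  1%:M - (norm2 p ^+ 2)^-1 *: (p *m p^T).

Variables (p : 'cV[R]_n) (ph p0 p1 : R).

Definition F : set ('cV[R]_n * R^o) :=
  [set z : 'cV[R]_n * R^o | p0 <= dot p z.1 + ph * z.2 <= p1].

Definition K0bar : set ('cV[R]_n * R^o) := conv_hull (K0 `\` F°).

Definition cf : R :=
  Num.sqrt ((norm2 p ^+ 2 - ph ^+ 2) *
            (norm2 p ^+ 2 * (p1 - p0) ^+ 2 - ph ^+ 2 * (p0 + p1) ^+ 2)).
Definition ca : R := (p0 + p1) * (norm2 p ^+ 2 - ph ^+ 2) / cf.
Definition cb : R := - (2 * p0 * p1 * norm2 p ^+ 2 / cf).
Definition cc : R := - (4 * p0 * p1 * ph / ((p1 - p0) * cf)).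
Definition cd : R := cf / ((p1 - p0) * (norm2 p ^+ 2 - ph ^+ 2)).
Definition ce : R := 2 * p0 * p1 * (p0 + p1) * ph / ((p1 - p0) * cf).

Definition C : set ('cV[R]_n * R^o) :=
  [set z : 'cV[R]_n * R^o |
    norm2 (Pperp p *m z.1 + ((ca * dot p z.1 + cb) / norm2 p ^+ 2) *: p)
    <= cc * dot p z.1 + cd * z.2 + ce].

End Defs.

(* Main.v *)
(* Write L(x, t) = p.x + ph t.  In cases (2) and (3) the cone lies on one side of one of the
   two hyperplanes L = p0, L = p1, and in case (1) the segment from the origin to a multiple
   of a point of the strip leaves the strip on both sides.

   In case (4), squaring the inequality that defines C gives
     |x|^2 <= t^2 + kappa (L - p0) (L - p1)   with kappa > 0,
   so outside the strip K0 implies C (up to the sign of the right-hand side of C), while on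
   the two bounding hyperplanes the inequalities are equivalent.  For the converse, the line
   through a point of C in the strip and the apex of the cone C meets both hyperplanes on the
   same side of the apex, hence in points of C, hence of K0; the given point lies between. *)
Require Import Defs.
From HB Require Import structures.
From mathcomp Require Import all_boot all_order all_algebra.
From mathcomp Require Import all_classical all_reals all_analysis.
From mathcomp Require Import ring lra.

Import Order.TTheory GRing.Theory Num.Theory.
Import numFieldNormedType.Exports.

Local Open Scope classical_set_scope.
Local Open Scope ring_scope.

Set Implicit Arguments.
Unset Strict Implicit.
Unset Printing Implicit Defensive.

(** * Euclidean inner product and norm *)

Section Euclidean.
Variables (R : realType) (n : nat).
Implicit Types (x y z p : 'cV[R]_n) (s : R).

Lemma dotE x y : dot x y = \sum_i x i 0 * y i 0.
Proof. by rewrite /dot mxE; apply: eq_bigr => i _; rewrite mxE. Qed.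

Lemma dotC x y : dot x y = dot y x.
Proof. by rewrite !dotE; apply: eq_bigr => i _; rewrite mulrC. Qed.

Lemma dotDr p x y : dot p (x + y) = dot p x + dot p y.
Proof. by rewrite /dot mulmxDr mxE. Qed.

Lemma dotZr p s x : dot p (s *: x) = s * dot p x.
Proof. by rewrite /dot -scalemxAr mxE. Qed.

Lemma dotDl p x y : dot (x + y) p = dot x p + dot y p.
Proof. by rewrite dotC dotDr !(dotC p). Qed.

Lemma dotZl p s x : dot (s *: x) p = s * dot x p.
Proof. by rewrite dotC dotZr dotC. Qed.

Lemma norm2_ge0 x : 0 <= norm2 x. Proof. exact: sqrtr_ge0. Qed.

Lemma sqr_norm2 x : norm2 x ^+ 2 = dot x x.
Proof. by rewrite dotE sqr_sqrtr ?sumr_ge0// => i _; rewrite sqr_ge0. Qed.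

Lemma dot_ge0 x : 0 <= dot x x. Proof. by rewrite -sqr_norm2 sqr_ge0. Qed.

Lemma norm2_le x s : (norm2 x <= s) = (0 <= s) && (dot x x <= s ^+ 2).
Proof.
case: (leP 0 s) => [s0|s0]; last by apply/negbTE; rewrite -ltNge (lt_le_trans s0)// norm2_ge0.
by rewrite -sqr_norm2 ler_sqr ?nnegrE ?norm2_ge0.
Qed.

Lemma dot_eq0 x : dot x x = 0 -> x = 0.
Proof.
rewrite dotE => /eqP; rewrite psumr_eq0 => [/allP x0|i _]; last by rewrite -expr2 sqr_ge0.
apply/colP => i; rewrite mxE; apply/eqP.
by have := x0 i (mem_index_enum i); rewrite -expr2 sqrf_eq0.
Qed.

Lemma sqr_dot_le x y : dot x y ^+ 2 <= dot x x * dot y y.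
Proof.
have [/dot_eq0 ->|y0] := eqVneq (dot y y) 0.
  by rewrite -(scale0r 0) !dotZr !mul0r mulr0 expr0n.
(* This square equals [dot y y] times the difference of the two sides of the claim. *)
have := dot_ge0 (dot y y *: x + (- dot x y) *: y).
rewrite !dotDl !dotDr !dotZl !dotZr (dotC y x) => h.
rewrite -subr_ge0 -(@pmulr_rge0 _ (dot y y)); last by rewrite lt_neqAle eq_sym y0 dot_ge0.
by apply: le_trans h _; rewrite le_eqVlt; apply/orP; left; apply/eqP; ring.
Qed.

Lemma norm_dot_le x y : `|dot x y| <= norm2 x * norm2 y.
Proof.
rewrite -ler_sqr ?nnegrE ?mulr_ge0 ?norm2_ge0// exprMn !sqr_norm2.
by rewrite real_normK ?num_real// sqr_dot_le.
Qed.

Lemma norm2D x y : norm2 (x + y) <= norm2 x + norm2 y.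
Proof.
rewrite norm2_le addr_ge0 ?norm2_ge0//= sqrrD !sqr_norm2 dotDl !dotDr (dotC y x).
have := le_trans (ler_norm _) (norm_dot_le x y); lra.
Qed.

Lemma norm2Z s x : 0 <= s -> norm2 (s *: x) = s * norm2 x.
Proof.
move=> s0; apply/eqP; rewrite -(@eqrXn2 _ 2) ?mulr_ge0 ?norm2_ge0//.
by rewrite exprMn !sqr_norm2 dotZl dotZr mulrA expr2.
Qed.

Lemma PperpE p x : Pperp p *m x = x - (dot p x / norm2 p ^+ 2) *: p.
Proof.
rewrite /Pperp mulmxBl mul1mx -scalemxAl -mulmxA; congr (_ - _).
by rewrite (mx11_scalar (p^T *m x)) mul_mx_scalar scalerA mulrC.
Qed.

(** Pythagoras: [Pperp p *m x] is orthogonal to [p]. *)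
Lemma dot_Pperp_shift p x s : norm2 p != 0 ->
  let y := Pperp p *m x + (s / norm2 p ^+ 2) *: p in
  dot y y = dot x x - dot p x ^+ 2 / norm2 p ^+ 2 + s ^+ 2 / norm2 p ^+ 2.
Proof.
move=> p0 /=; rewrite PperpE -scaleNr !dotDl !dotDr !dotZl !dotZr (dotC x p) -(sqr_norm2 p).
by field.
Qed.

End Euclidean.

(** * Sign of the right-hand side of the inequality defining [C] *)

Section Slack.
Variable R : realFieldType.

(* This is [(p1 - p0) * cf] times the right-hand side of the inequality defining C, as a
   function of [L = dot p x + h * t] and [t], with [N] the norm of [p]. *)
Definition slack (N h p0 p1 L t : R) : R :=
  - (2 * p0 * p1) * h * (2 * L - (p0 + p1)) + (N ^+ 2 - h ^+ 2) * (p1 - p0) ^+ 2 * t.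

(** Here [s] stands for [dot p x], bounded by Cauchy-Schwarz on the cone. Beyond [p1] both summands
    of [slack] are nonnegative; below [p0] the first is not, and the height [t] must compensate. *)
Lemma slack_ge0_pos (N h p0 p1 t s : R) : 0 <= h -> h < N -> p0 < 0 -> 0 < p1 ->
  0 <= t -> `|s| <= N * t ->
  s + h * t <= p0 \/ p1 <= s + h * t -> 0 <= slack N h p0 p1 (s + h * t) t.
Proof.
move=> h0 hN p00 p10 t0; rewrite ler_norml /slack => /andP[s1 s2].
have m0 : 0 <= - (p0 * p1) by nra.
have m1 : 0 <= - (p0 * p1) * h by apply: mulr_ge0.
case=> L.
(* With [q = - p0] and [l = - (s + h * t)], [slack] is the sum of the terms of [H1], [H2] and twice
   those of [H3] and [H4]. [H1] carries the lower bound on [t] given by [|s| <= N * t]. *)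
- have [q qE] : exists q, q = - p0 by exists (- p0).
  have [l lE] : exists l, l = - (s + h * t) by exists (- (s + h * t)).
  have -> : s + h * t = - l by lra.
  have -> : p0 = - q by lra.
  have ql : q <= l by lra.
  have q0 : 0 < q by lra.
  have lt : l <= (N - h) * t by lra.
  have H1 : 0 <= (N + h) * (p1 + q) ^+ 2 * ((N - h) * t - l).
    by rewrite !mulr_ge0 ?sqr_ge0//; lra.
  have H2 : 0 <= (N - h) * (p1 + q) ^+ 2 * l.
    by rewrite !mulr_ge0 ?sqr_ge0//; lra.
  have H3 : 0 <= h * ((p1 ^+ 2 + q ^+ 2) * (l - q)).
    by rewrite !mulr_ge0//; nra.
  have H4 : 0 <= h * (q * (q ^+ 2 + p1 * q)).
    by rewrite !mulr_ge0//; nra.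
  by lra.
- apply: addr_ge0.
    by apply: mulr_ge0; lra.
  by rewrite !mulr_ge0 ?sqr_ge0//; nra.
Qed.

(** Changing the sign of the linear form exchanges the two hyperplanes; this reduces everything to
    [0 <= h]. *)
Lemma slack_opp (N h p0 p1 L t : R) : slack N h p0 p1 L t = slack N (- h) (- p1) (- p0) (- L) t.
Proof. by rewrite /slack; ring. Qed.

Lemma slack_ge0 (N h p0 p1 t s : R) : `|h| < N -> p0 < 0 -> 0 < p1 ->
  0 <= t -> `|s| <= N * t ->
  s + h * t <= p0 \/ p1 <= s + h * t -> 0 <= slack N h p0 p1 (s + h * t) t.
Proof.
move=> + p00 p10 t0 sN; rewrite ltr_norml => /andP[h1 h2].
have [h0|h0] := leP 0 h; first exact: slack_ge0_pos.
move=> sL; rewrite slack_opp opprD -mulNr; by apply: slack_ge0_pos; rewrite ?normrN//; lra.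
Qed.

(** On a bounding hyperplane the squared inequality only gives [|x| <= |t|]; the sign of [slack]
    rules out the lower nappe. For [t < 0], [slack] is shown to be negative. *)
Lemma slack_ge0_height_pos (N h p0 p1 t s : R) : 0 <= h -> h < N -> p0 < 0 -> 0 < p1 ->
  `|s| <= N * `|t| -> s + h * t = p0 \/ s + h * t = p1 ->
  0 <= slack N h p0 p1 (s + h * t) t -> 0 <= t.
Proof.
move=> h0 hN p00 p10 sN sL; apply: contraTT; rewrite -!ltNge => t0.
move: sN; rewrite (ltr0_norm t0) ler_norml /slack => /andP[s1 s2].
have H0 : 0 < (p1 - p0) ^+ 2 by rewrite exprn_gt0//; lra.
have H : 0 < (N ^+ 2 - h ^+ 2) * (p1 - p0) ^+ 2 * - t by rewrite !mulr_gt0//; nra.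
have m0 : 0 < - (p0 * p1) by nra.
case: sL => sL; rewrite sL.
- have : 0 <= h * (- (p0 * p1) * (p1 - p0)) by rewrite !mulr_ge0//; lra.
  by lra.
- have H1 : 0 <= (N + h) * (p1 - p0) ^+ 2 * ((N - h) * - t - p1).
    by rewrite !mulr_ge0 ?(ltW H0)//; nra.
  have H2 : 0 < (N - h) * (p1 - p0) ^+ 2 * p1.
    by rewrite !mulr_gt0//; lra.
  have H3 : 0 <= h * p1 * ((p1 - p0) * p1).
    by rewrite !mulr_ge0//; lra.
  by lra.
Qed.

Lemma slack_ge0_height (N h p0 p1 t s : R) : `|h| < N -> p0 < 0 -> 0 < p1 ->
  `|s| <= N * `|t| -> s + h * t = p0 \/ s + h * t = p1 ->
  0 <= slack N h p0 p1 (s + h * t) t -> 0 <= t.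
Proof.
move=> + p00 p10 sN; rewrite ltr_norml => /andP[h1 h2].
have [h0|h0] := leP 0 h; first exact: slack_ge0_height_pos.
move=> sL; rewrite slack_opp opprD -mulNr; by apply: slack_ge0_height_pos; rewrite ?normrN//; lra.
Qed.

End Slack.

(** * Convex sets given by norm inequalities between affine maps *)

Section Convexity.
Variables (R : realType).

Lemma convex_setP (M : lmodType R) (A : set M) :
  @convex_set R M A <->
  forall u v (s : R), 0 <= s -> s <= 1 -> A u -> A v -> A (s *: u + (1 - s) *: v).
Proof.
split=> [cA u v s s0 s1 Au Av|cA u v s].
  by have /= := cA u v (Itv01 s0 s1); rewrite !inE; apply.
by rewrite !inE => Au Av; exact: cA.
Qed.

Lemma convex_setI (M : lmodType R) (A B : set M) :
  @convex_set R M A -> @convex_set R M B -> @convex_set R M (A `&` B).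
Proof.
move=> /convex_setP cA /convex_setP cB; apply/convex_setP => u v s s0 s1 [Au Bu] [Av Bv].
by split; [exact: cA|exact: cB].
Qed.

Definition affine_map {M V : lmodType R} (f : M -> V) :=
  forall (s : R) u v, f (s *: u + (1 - s) *: v) = s *: f u + (1 - s) *: f v.

Lemma convex_set_norm2_le n (M : lmodType R) (f : M -> 'cV[R]_n) (g : M -> R^o) :
  affine_map f -> affine_map g -> @convex_set R M [set z | norm2 (f z) <= g z].
Proof.
move=> fa ga; apply/convex_setP => u v s s0 s1 /= fu fv; rewrite fa ga.
have s1' : 0 <= 1 - s by rewrite subr_ge0.
apply: le_trans (norm2D _ _) _; rewrite !norm2Z//.
by apply: lerD; exact: ler_wpM2l.
Qed.

End Convexity.

(** * The cone, the open strip and the hull *)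

Section SplitCut.
Variables (R : realType) (n : nat) (p : 'cV[R]_n) (ph p0 p1 : R).
Implicit Types (z u v : ('cV[R]_n * R^o)%type) (s : R).

Definition lin z : R := dot p z.1 + ph * z.2.

Lemma affine_dot : affine_map (fun z => dot p z.1 : R^o).
Proof. by move=> s u v; rewrite /= dotDr !dotZr. Qed.

Lemma affine_lin : affine_map (lin : _ -> R^o).
Proof. by move=> s u v; rewrite /lin affine_dot /= /GRing.scale /=; ring. Qed.

Lemma convex_K0 : @convex_set R ('cV[R]_n * R^o)%type (@K0 R n).
Proof. by apply: convex_set_norm2_le. Qed.

Lemma convex_C : @convex_set R ('cV[R]_n * R^o)%type (C p ph p0 p1).
Proof.
apply: convex_set_norm2_le => s u v; rewrite affine_dot /=.
  rewrite mulmxDr -!scalemxAr !scalerDr !scalerA addrACA -scalerDl.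
  by congr (_ + _ *: _); rewrite /GRing.scale /=; ring.
by rewrite /GRing.scale /=; ring.
Qed.

Lemma K0E z : @K0 R n z <-> 0 <= z.2 /\ dot z.1 z.1 <= z.2 ^+ 2.
Proof. by rewrite /K0 /= norm2_le; split=> /andP. Qed.

Lemma K0_ge0 z : @K0 R n z -> 0 <= z.2.
Proof. by move/K0E => []. Qed.

Lemma K0_dot_le z : @K0 R n z -> `|dot p z.1| <= norm2 p * z.2.
Proof.
by move=> Kz; apply: le_trans (norm_dot_le _ _) _; rewrite ler_wpM2l ?norm2_ge0.
Qed.

Lemma K0Z s z : 0 <= s -> @K0 R n z -> @K0 R n (s *: z).
Proof. by move=> s0; rewrite /K0 /= norm2Z// => Kz; exact: ler_wpM2l. Qed.

Lemma continuous_lin : continuous lin.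
Proof.
move=> z; apply: cvgD.
  rewrite [X in X @ _](_ : _ = fun u => \sum_i p i 0 * u.1 i 0); last first.
    by apply/funext => u /=; rewrite dotE.
  rewrite /= dotE; apply: cvg_big => [|i _]; first exact: add_continuous.
  apply: cvgM; first exact: cvg_cst.
  apply: (cvg_comp fst (fun x : 'cV[R]_n => x i 0)); first exact: cvg_fst.
  exact: coord_continuous.
by apply: cvgM; [exact: cvg_cst|exact: cvg_snd].
Qed.

Lemma interior_F : ph != 0 -> (F p ph p0 p1)° = [set z | p0 < lin z < p1].
Proof.
move=> ph0; apply/seteqP; split=> z; last first.
  rewrite /= => zi; have : open (lin @^-1` `]p0, p1[%classic).
    by apply: open_comp => [? _|]; [exact: continuous_lin|exact: interval_open].
  rewrite openE => /(_ z); rewrite /= in_itv => /(_ zi).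
  apply: interiorS => u; rewrite /= in_itv /F /= => /andP[? ?].
  by rewrite !ltW.
rewrite /interior /= => zF.
(* Moving [z] by [e * ph] in the last coordinate changes [lin] by [e * ph ^+ 2], which has the sign
   of [e]; a step each way makes both bounds strict. *)
have : \forall e \near (0 : R), F p ph p0 p1 (z.1, z.2 + e * ph : R^o).
  have : (z.1, z.2 + e * ph : R^o) @[e --> (0 : R)] --> z.
    rewrite [X in _ --> X](_ : _ = (z.1, z.2 + 0 * ph)); last first.
      by rewrite mul0r addr0; case: z {zF}.
    apply: (cvg_pair (G := nbhs z.1) (H := nbhs (z.2 + 0 * ph))); first exact: cvg_cst.
    by apply: cvgD; [exact: cvg_cst|apply: cvgM; [exact: cvg_id|exact: cvg_cst]].
  by move=> /(_ _ zF).
move=> /nbhs_ballP[e /= e0 eF].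
have ph2 : 0 < ph ^+ 2 by rewrite exprn_even_gt0.
have eE (d : R) : `|d| < e -> p0 <= lin z + d * ph ^+ 2 <= p1.
  move=> de; have : F p ph p0 p1 (z.1, z.2 + d * ph : R^o).
    by apply: eF; rewrite /ball /= sub0r normrN.
  by rewrite /F /lin /= => /andP[? ?]; apply/andP; split; lra.
have e2 : `|e / 2| < e by rewrite gtr0_norm; lra.
have /eE/andP[_ H1] := e2.
have /eE/andP[H2 _] : `|- (e / 2)| < e by rewrite normrN.
have : 0 < (e / 2) * ph ^+ 2 by rewrite mulr_gt0//; lra.
by move=> ?; apply/andP; split; lra.
Qed.

Lemma K0bar_sub (A : set ('cV[R]_n * R^o)) : ph != 0 ->
  @convex_set R ('cV[R]_n * R^o)%type A ->
  (forall z, @K0 R n z -> lin z <= p0 \/ p1 <= lin z -> A z) ->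
  K0bar p ph p0 p1 `<=` A.
Proof.
move=> ph0 cA KA; apply: smallest_sub => // z [Kz]; rewrite interior_F//= => /negP.
rewrite negb_and -!leNgt => zF; apply: KA => //; exact/orP.
Qed.

Lemma sub_K0bar z : ph != 0 -> @K0 R n z -> lin z <= p0 \/ p1 <= lin z -> K0bar p ph p0 p1 z.
Proof.
move=> ph0 Kz zF; apply: sub_gen_smallest; split=> //; rewrite interior_F//=.
by case: zF => ? /andP[? ?]; lra.
Qed.

Lemma K0bar_conv u v s : 0 <= s -> s <= 1 ->
  K0bar p ph p0 p1 u -> K0bar p ph p0 p1 v -> K0bar p ph p0 p1 (s *: u + (1 - s) *: v).
Proof.
move=> s0 s1 Ku Kv A hA; have [/convex_setP cA _] := hA.
by apply: cA => //; [exact: Ku|exact: Kv].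
Qed.

(** * The quadratic form of [C] and homotheties centred at its apex *)

Lemma sqr_norm2_gt : `|ph| < norm2 p -> 0 < norm2 p ^+ 2 - ph ^+ 2.
Proof.
by move=> phN; rewrite subr_gt0 -(real_normK (num_real ph)) ltr_sqr ?nnegrE ?norm2_ge0.
Qed.

(** For [p0 < 0 < p1], the nonzero coefficient that makes the quadric bounding [C] singular, hence a
    cone again (a cylinder when [p0 + p1 = 0]). *)
Definition kappa : R := - (4 * p0 * p1) / ((p1 - p0) ^+ 2 * (norm2 p ^+ 2 - ph ^+ 2)).

Lemma CE z : `|ph| < norm2 p -> p0 < 0 -> 0 < p1 ->
  C p ph p0 p1 z <->
  0 <= slack (norm2 p) ph p0 p1 (lin z) z.2 /\
  dot z.1 z.1 <= z.2 ^+ 2 + kappa * ((lin z - p0) * (lin z - p1)).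
Proof.
move=> phN p00 p10; set N := norm2 p.
have N0 : 0 < N by apply: le_lt_trans phN.
have D1 : 0 < N ^+ 2 - ph ^+ 2 by exact: sqr_norm2_gt.
have d0 : 0 < p1 - p0 by lra.
(* The quantity is [(N ^+ 2 - ph ^+ 2) * (p0 + p1) ^+ 2 - 4 * N ^+ 2 * p0 * p1]; so [cf] is the root
   of a positive number. *)
have D2 : 0 < N ^+ 2 * (p1 - p0) ^+ 2 - ph ^+ 2 * (p0 + p1) ^+ 2.
  have : 0 <= (N ^+ 2 - ph ^+ 2) * (p0 + p1) ^+ 2 by rewrite mulr_ge0 ?sqr_ge0 ?ltW.
  have : 0 < N ^+ 2 * (- p0 * p1) by rewrite !mulr_gt0// oppr_gt0.
  lra.
have f2 : cf p ph p0 p1 ^+ 2 = (N ^+ 2 - ph ^+ 2) *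
    (N ^+ 2 * (p1 - p0) ^+ 2 - ph ^+ 2 * (p0 + p1) ^+ 2).
  by rewrite sqr_sqrtr// mulr_ge0// ltW.
have f0 : 0 < cf p ph p0 p1 by rewrite sqrtr_gt0 mulr_gt0.
have lE : cc p ph p0 p1 * dot p z.1 + cd p ph p0 p1 * z.2 + ce p ph p0 p1 =
    slack N ph p0 p1 (lin z) z.2 / ((p1 - p0) * cf p ph p0 p1).
  rewrite /cc /ce /cd -/N.
  rewrite (_ : cf p ph p0 p1 / _ =
    cf p ph p0 p1 ^+ 2 / ((p1 - p0) * (N ^+ 2 - ph ^+ 2) * cf p ph p0 p1)); last first.
    by field; rewrite !gt_eqF.
  by rewrite f2 /slack /lin; field; rewrite !gt_eqF.
rewrite /C /= norm2_le dot_Pperp_shift ?gt_eqF// lE -/N.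
rewrite pmulr_lge0 ?invr_gt0 ?mulr_gt0//.
set l := slack _ _ _ _ _ _; set w := ca _ _ _ _ * _ + _.
have wE : w ^+ 2 = ((p0 + p1) * (N ^+ 2 - ph ^+ 2) * dot p z.1 - 2 * p0 * p1 * N ^+ 2) ^+ 2 /
    cf p ph p0 p1 ^+ 2.
  by rewrite /w /ca /cb -/N; field; rewrite gt_eqF.
have -> : (dot z.1 z.1 - dot p z.1 ^+ 2 / N ^+ 2 + w ^+ 2 / N ^+ 2 <=
     (l / ((p1 - p0) * cf p ph p0 p1)) ^+ 2) =
    (dot z.1 z.1 <= z.2 ^+ 2 + kappa * ((lin z - p0) * (lin z - p1))).
  rewrite -subr_ge0 -[RHS]subr_ge0; congr (0 <= _).
  rewrite wE expr_div_n exprMn f2 /l /slack /kappa /lin -/N.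
  by field; rewrite -?exprMn !gt_eqF ?exprMn.
by split=> /andP.
Qed.


(* [ray z] is, up to the factor [p0 + p1], the vector from the apex of the cone C to z; it
   stays meaningful when [p0 + p1 = 0], where the apex escapes to infinity. *)
Definition ray z : ('cV[R]_n * R^o)%type :=
  let mu := - (2 * p0 * p1) / (norm2 p ^+ 2 - ph ^+ 2) in
  ((p0 + p1) *: z.1 + mu *: p, (p0 + p1) * z.2 - mu * ph).

Lemma lin_ray z s : norm2 p ^+ 2 - ph ^+ 2 != 0 ->
  lin (z + s *: ray z) = lin z + s * ((p0 + p1) * lin z - 2 * p0 * p1).
Proof.
move=> D1; rewrite /lin /ray /= /GRing.scale /= !(dotDr, dotZr) -(sqr_norm2 p).
by field.
Qed.

(** If [p0 + p1 != 0], [z + s *: ray z] is the image of [z] under the homothety of ratio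
    [1 + s * (p0 + p1)] centred at the apex. There the affine function [slack] vanishes and the
    quadric is singular, so they scale by the ratio and by its square. *)
Lemma slack_ray z s : norm2 p ^+ 2 - ph ^+ 2 != 0 ->
  slack (norm2 p) ph p0 p1 (lin (z + s *: ray z)) (z + s *: ray z).2 =
  (1 + s * (p0 + p1)) * slack (norm2 p) ph p0 p1 (lin z) z.2.
Proof.
by move=> D1; rewrite lin_ray// /slack /= /GRing.scale /=; field.
Qed.

Lemma quadric_ray z s : norm2 p ^+ 2 - ph ^+ 2 != 0 -> p1 - p0 != 0 ->
  let q u := u.2 ^+ 2 + kappa * ((lin u - p0) * (lin u - p1)) - dot u.1 u.1 in
  q (z + s *: ray z) = (1 + s * (p0 + p1)) ^+ 2 * q z.
Proof.
move=> D1 d0 /=; rewrite lin_ray// /kappa /lin /= /GRing.scale /=.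
rewrite !(dotDl, dotDr, dotZl, dotZr) (dotC z.1 p) -(sqr_norm2 p).
by field; rewrite D1.
Qed.

(** A nonnegative ratio preserves both inequalities of [CE]. At [lin = b] the [kappa] term vanishes,
    leaving the double cone, and [slack_ge0_height] selects its upper half. *)
Lemma C_hit z s b : `|ph| < norm2 p -> p0 < 0 -> 0 < p1 -> C p ph p0 p1 z ->
  0 <= 1 + s * (p0 + p1) -> b = p0 \/ b = p1 -> lin (z + s *: ray z) = b ->
  @K0 R n (z + s *: ray z).
Proof.
move=> phN p00 p10 /(CE _ phN p00 p10) [l0 q0] s0 bE Lb.
have D1 := sqr_norm2_gt phN.
have d0 : p1 - p0 != 0 by rewrite gt_eqF//; lra.
have := quadric_ray z s (lt0r_neq0 D1) d0; have := slack_ray z s (lt0r_neq0 D1).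
move: (z + s *: ray z) Lb => u Lb lu /=; rewrite Lb.
have -> : (b - p0) * (b - p1) = 0 by case: bE => ->; rewrite subrr ?mul0r ?mulr0.
rewrite mulr0 addr0 => qu.
have qu0 : dot u.1 u.1 <= u.2 ^+ 2.
  by rewrite -subr_ge0 qu mulr_ge0 ?sqr_ge0// subr_ge0.
apply/K0E; split=> //.
apply: (@slack_ge0_height _ (norm2 p) ph p0 p1 _ (dot p u.1)) => //.
- apply: le_trans (norm_dot_le _ _) _; rewrite ler_wpM2l ?norm2_ge0//.
  by rewrite norm2_le normr_ge0/= real_normK ?num_real.
- by move: Lb; rewrite /lin => ->.
- by rewrite -/(lin u) lu mulr_ge0.
Qed.

(** * The hull in the four cases *)

Lemma K0I_C_sub : ph != 0 -> `|ph| < norm2 p -> p0 < 0 -> 0 < p1 ->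
  @K0 R n `&` C p ph p0 p1 `<=` K0bar p ph p0 p1.
Proof.
move=> ph0 phN p00 p10 z [Kz Cz].
have [L0|L0] := leP (lin z) p0; first by apply: sub_K0bar => //; left.
have [L1|L1] := leP p1 (lin z); first by apply: sub_K0bar => //; right.
have D1 : norm2 p ^+ 2 - ph ^+ 2 != 0 by rewrite gt_eqF// sqr_norm2_gt.
(* [r] is the rate of change of [lin] along [ray z]. It equals
   [- p0 * (p1 - lin z) + p1 * (lin z - p0)], positive in the strip. *)
pose r := (p0 + p1) * lin z - 2 * p0 * p1.
have d0 : 0 < p1 - p0 by lra.
have r0 : 0 < r.
  have : 0 < - p0 * (p1 - lin z) by rewrite mulr_gt0//; lra.
  have : 0 < p1 * (lin z - p0) by rewrite mulr_gt0//; lra.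
  by rewrite /r; lra.
have rn0 : r != 0 by rewrite gt_eqF.
pose u b := z + ((b - lin z) / r) *: ray z.
have Lu b : lin (u b) = b by rewrite lin_ray// -/r divfK// addrCA subrr addr0.
have Ku b : b = p0 \/ b = p1 -> K0bar p ph p0 p1 (u b).
  move=> bE; apply: sub_K0bar => //; last by rewrite Lu; case: bE => ->; [left|right].
  apply: (C_hit (b := b)) => //; last exact: Lu.
  (* The homothety ratio reaching [lin = b]; its numerator is [- p0 * (p1 - p0)] or
     [p1 * (p1 - p0)], so both hits are on the same side of the apex as [z]. *)
  rewrite (_ : 1 + _ = ((p0 + p1) * b - 2 * p0 * p1) / r); last by rewrite /r; field.
  rewrite divr_ge0 ?(ltW r0)//.
  have p0d : 0 <= - p0 * (p1 - p0) by rewrite mulr_ge0//; lra.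
  have p1d : 0 <= p1 * (p1 - p0) by rewrite mulr_ge0//; lra.
  by case: bE => ->; lra.
have -> : z = ((p1 - lin z) / (p1 - p0)) *: u p0 +
              (1 - (p1 - lin z) / (p1 - p0)) *: u p1.
  rewrite /u !scalerDr addrACA -scalerDl !scalerA -scalerDl.
  rewrite -[LHS]scale1r -[LHS]addr0 -(scale0r (ray z)).
  by congr (_ *: _ + _ *: _); field; rewrite ?rn0 gt_eqF.
apply: (K0bar_conv _ _ (Ku _ (or_introl erefl)) (Ku _ (or_intror erefl))).
- by rewrite divr_ge0//; lra.
- by rewrite ler_pdivrMr//; lra.
Qed.

Lemma K0bar_sub_C : ph != 0 -> `|ph| < norm2 p -> p0 < 0 -> 0 < p1 ->
  K0bar p ph p0 p1 `<=` @K0 R n `&` C p ph p0 p1.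
Proof.
move=> ph0 phN p00 p10; apply: K0bar_sub => //.
  exact: convex_setI convex_K0 convex_C.
move=> z Kz zL; split=> //; apply/CE => //; split.
  by apply: slack_ge0 => //; [exact: K0_ge0|exact: K0_dot_le].
have /K0E[_ /le_trans] := Kz; apply; rewrite lerDl mulr_ge0//.
  rewrite /kappa divr_ge0//; first by nra.
  by rewrite mulr_ge0 ?sqr_ge0// ltW// sqr_norm2_gt.
by case: zL => ?; [rewrite mulr_le0|rewrite mulr_ge0]; lra.
Qed.

Lemma K0bar_full : ph != 0 -> p0 < p1 -> 0 <= p0 \/ p1 <= 0 ->
  K0bar p ph p0 p1 = @K0 R n.
Proof.
move=> ph0 p01 p00; apply/seteqP; split.
  by apply: K0bar_sub => //; exact: convex_K0.
move=> z Kz.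
have [L0|L0] := leP (lin z) p0; first by apply: sub_K0bar => //; left.
have [L1|L1] := leP p1 (lin z); first by apply: sub_K0bar => //; right.
have linZ s : lin (s *: z) = s * lin z.
  by rewrite /lin /= /GRing.scale /= dotZr; ring.
(* [b] is the bound farther from 0, so [z] lies between the origin and its multiple on the
   hyperplane [lin = b], both outside the open strip. *)
have [b [b0 bL bF]] : exists b, [/\ 0 < lin z / b, lin z / b <= 1 & b <= p0 \/ p1 <= b].
  case: p00 => p00; [exists p1|exists p0].
    by rewrite divr_gt0 ?ler_pdivrMr; try lra; split=> //; lra.
  rewrite -(mulrNN (lin z)) -invrN divr_gt0 ?ler_pdivrMr; try lra; split=> //; lra.
have Ln0 : lin z != 0 by apply: contraTneq b0 => ->; rewrite mul0r ltxx.
have bn0 : b != 0 by apply: contraTneq b0 => ->; rewrite invr0 mulr0 ltxx.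
have -> : z = (lin z / b) *: ((b / lin z) *: z) + (1 - lin z / b) *: (0 *: z).
  by rewrite !scalerA mulr0 scale0r addr0 mulrA divfK// divff// scale1r.
apply: (K0bar_conv (ltW b0) bL).
  apply: sub_K0bar => //; last by rewrite linZ divfK.
  by apply: K0Z => //; rewrite -invf_div invr_ge0 ltW.
apply: sub_K0bar => //; first exact: K0Z.
by rewrite linZ mul0r.
Qed.

(** By Cauchy-Schwarz, [lin z <= (norm2 p + ph) * z.2 <= 0 < p1] on the cone, so only the side
    [lin z <= p0] remains. *)
Lemma K0bar_le : ph != 0 -> p0 < 0 -> 0 < p1 -> ph <= - norm2 p ->
  K0bar p ph p0 p1 = [set z : 'cV[R]_n * R^o | @K0 R n z /\ lin z <= p0].
Proof.
move=> ph0 p00 p10 phN; apply/seteqP; split; last first.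
  by move=> z [Kz zL]; apply: sub_K0bar => //; left.
apply: K0bar_sub => // [|z Kz [//|L1]].
  apply: convex_setI convex_K0 _; apply/convex_setP => u v s s0 s1 /= Lu Lv.
  have := affine_lin s u v; rewrite /GRing.scale /= => ->.
  have : 0 <= (1 - s) * (p0 - lin v) by rewrite mulr_ge0//; lra.
  have : 0 <= s * (p0 - lin u) by rewrite mulr_ge0//; lra.
  by lra.
have := K0_dot_le Kz; rewrite ler_norml => /andP[_ sN].
have := K0_ge0 Kz => t0.
have : 0 <= (- norm2 p - ph) * z.2 by rewrite mulr_ge0//; lra.
by move: L1; rewrite /lin; lra.
Qed.

Lemma K0bar_ge : ph != 0 -> p0 < 0 -> 0 < p1 -> norm2 p <= ph ->
  K0bar p ph p0 p1 = [set z : 'cV[R]_n * R^o | @K0 R n z /\ p1 <= lin z].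
Proof.
move=> ph0 p00 p10 phN; apply/seteqP; split; last first.
  by move=> z [Kz zL]; apply: sub_K0bar => //; right.
apply: K0bar_sub => // [|z Kz [L0|//]].
  apply: convex_setI convex_K0 _; apply/convex_setP => u v s s0 s1 /= Lu Lv.
  have := affine_lin s u v; rewrite /GRing.scale /= => ->.
  have : 0 <= (1 - s) * (lin v - p1) by rewrite mulr_ge0//; lra.
  have : 0 <= s * (lin u - p1) by rewrite mulr_ge0//; lra.
  by lra.
have := K0_dot_le Kz; rewrite ler_norml => /andP[sN _].
have := K0_ge0 Kz => t0.
have : 0 <= (ph - norm2 p) * z.2 by rewrite mulr_ge0//; lra.
by move: L0; rewrite /lin; lra.
Qed.

End SplitCut.

Unset Implicit Arguments.

Theorem proposition4p3 (R : realType) (n : nat) (p : 'cV[R]_n) (ph p0 p1 : R)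
    (hph : ph != 0) (hp01 : p0 < p1) :
  [/\ (0 \notin `]p0, p1[ -> K0bar p ph p0 p1 = @K0 R n),
      (0 \in `]p0, p1[ -> ph <= - norm2 p ->
        K0bar p ph p0 p1 =
          [set z : 'cV[R]_n * R^o | @K0 R n z /\ dot p z.1 + ph * z.2 <= p0]),
      (0 \in `]p0, p1[ -> norm2 p <= ph ->
        K0bar p ph p0 p1 =
          [set z : 'cV[R]_n * R^o | @K0 R n z /\ p1 <= dot p z.1 + ph * z.2])
    & (0 \in `]p0, p1[ -> ph \in `](- norm2 p), (norm2 p)[ ->
        K0bar p ph p0 p1 = @K0 R n `&` C p ph p0 p1)].
Proof.
split; rewrite in_itv /=.
- rewrite negb_and -!leNgt => /orP p00; exact: K0bar_full.
- by move=> /andP[p00 p10]; exact: K0bar_le.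
- by move=> /andP[p00 p10]; exact: K0bar_ge.
move=> /andP[p00 p10]; rewrite in_itv /= -ltr_norml => phN.
by apply/seteqP; split; [exact: K0bar_sub_C|exact: K0I_C_sub].
Qed.
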